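(* Let $n\ge1$. For any set of formulas $\Gamma$ and formula $\alpha$, if $\Gamma\vDash_n\alpha$ then $\Gamma\vdash_n\alpha$.
   Context: Formulas are built from a countably infinite set of propositional variables and $\bot$ using $\land,\lor,\to$; $\neg\alpha:=\alpha\to\bot$; intuitionistic Kripke semantics with valuations assigning upward-closed sets. $\mathfrak{F}_n=\langle\wp^*(n),\supseteq\rangle$, where $n=\{0,\dots,n-1\}$ and $\wp^*(n)$ is the set of non-empty subsets of $n$; its root is $n$. $\Gamma\vDash_n\varphi$ means: for every valuation $V$ on $\mathfrak{F}_n$, if $\mathfrak{F}_n,V,n\vDash\gamma$ for all $\gamma\in\Gamma$ then $\mathfrak{F}_n,V,n\vDash\varphi$. $\mathbf{ML}_n$ is the smallest superintuitionistic logic (containing intuitionistic propositional logic, closed under modus ponens and uniform substitution) that contains all instances of $\boldsymbol{kp}$: $(\neg p\to q\lor r)\to(\neg p\to q)\lor(\neg p\to r)$ and $\boldsymbol{bd}_n$: $p_n\lor(p_n\to(p_{n-1}\lor(p_{n-1}\to(\cdots(p_1\lor(p_1\to\bot))\cdots))))$, and is closed under the rule $\boldsymbol{Ed}_n$: from $\alpha\to(\beta\lor\bigvee_{i=1}^n\neg\lambda_i)$ infer $\alpha\to\beta$, where $p_1,\dots,p_n$ are distinct variables not occurring in $\alpha$ or $\beta$ and $\lambda_i=p_i\land\bigwedge_{j\neq i}\neg p_j$. $\Gamma\vdash_n\varphi$ means there are finitely many $\gamma_1,\dots,\gamma_k\in\Gamma$ with $\bigwedge_i\gamma_i\to\varphi\in\mathbf{ML}_n$.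 *)

(* Defs.v *)
From Stdlib Require List.
From mathcomp Require Import all_boot.
Set Implicit Arguments. Unset Strict Implicit. Unset Printing Implicit Defensive.

Inductive form : Type :=
| Var : nat -> form
| Bot : form
| And : form -> form -> form
| Or  : form -> form -> form
| Imp : form -> form -> form.

Definition Neg (a : form) : form := Imp a Bot.
Definition Top : form := Imp Bot Bot.

Fixpoint bigAnd (l : seq form) : form :=
  match l with
  | [::] => Top
  | [:: a] => a
  | a :: l' => And a (bigAnd l')
  end.

Fixpoint bigOr (l : seq form) : form :=
  match l with
  | [::] => Bot
  | [:: a] => a
  | a :: l' => Or a (bigOr l')
  end.

Fixpoint vars (a : form) : seq nat :=
  match a with
  | Var p => [:: p]
  | Bot => [::]
  | And b c | Or b c | Imp b c => vars b ++ vars c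
  end.

Fixpoint subst (s : nat -> form) (a : form) : form :=
  match a with
  | Var p => s p
  | Bot => Bot
  | And b c => And (subst s b) (subst s c)
  | Or b c => Or (subst s b) (subst s c)
  | Imp b c => Imp (subst s b) (subst s c)
  end.

Definition kp : form :=
  Imp (Imp (Neg (Var 0)) (Or (Var 1) (Var 2)))
      (Or (Imp (Neg (Var 0)) (Var 1)) (Imp (Neg (Var 0)) (Var 2))).

Fixpoint bd (k : nat) : form :=
  match k with
  | 0 => Bot
  | k'.+1 => Or (Var k'.+1) (Imp (Var k'.+1) (bd k'))
  end.

Definition lam (ps : seq nat) (p : nat) : form :=
  And (Var p) (bigAnd [seq Neg (Var q) | q <- ps & q != p]).

Inductive ML (n : nat) : form -> Prop :=
| ax_K  a b   : ML n (Imp a (Imp b a))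
| ax_S  a b c : ML n (Imp (Imp a (Imp b c)) (Imp (Imp a b) (Imp a c)))
| ax_A1 a b   : ML n (Imp (And a b) a)
| ax_A2 a b   : ML n (Imp (And a b) b)
| ax_A3 a b   : ML n (Imp a (Imp b (And a b)))
| ax_O1 a b   : ML n (Imp a (Or a b))
| ax_O2 a b   : ML n (Imp b (Or a b))
| ax_O3 a b c : ML n (Imp (Imp a c) (Imp (Imp b c) (Imp (Or a b) c)))
| ax_E  a     : ML n (Imp Bot a)
| ax_kp : ML n kp
| ax_bd : ML n (bd n)
| r_MP a b : ML n (Imp a b) -> ML n a -> ML n b
| r_US (s : nat -> form) a : ML n a -> ML n (subst s a)
| r_Ed (a b : form) (ps : seq nat) :
    size ps = n -> uniq ps ->
    (forall p, p \in ps -> p \notin vars a /\ p \notin vars b) ->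
    ML n (Imp a (Or b (bigOr [seq Neg (lam ps p) | p <- ps]))) ->
    ML n (Imp a b).

Definition derives (n : nat) (Gamma : form -> Prop) (phi : form) : Prop :=
  exists l : seq form, (forall g, List.In g l -> Gamma g) /\ ML n (Imp (bigAnd l) phi).

(* ---------- Kripke semantics on F_n = <nonempty subsets of n, superseteq> ---------- *)
Definition world (n : nat) (w : {set 'I_n}) : Prop := w != set0.

(* valuations: upward closed along the order  w <= v  iff  v \subset w *)
Definition valuation (n : nat) (V : nat -> {set 'I_n} -> Prop) : Prop :=
  forall p (w v : {set 'I_n}), world w -> world v -> v \subset w -> V p w -> V p v.

Fixpoint forces (n : nat) (V : nat -> {set 'I_n} -> Prop) (w : {set 'I_n}) (a : form)
  : Prop :=
  match a with
  | Var p => V p w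
  | Bot => False
  | And b c => forces V w b /\ forces V w c
  | Or b c => forces V w b \/ forces V w c
  | Imp b c => forall v : {set 'I_n}, world v -> v \subset w ->
                 forces V v b -> forces V v c
  end.

(* Gamma |=_n phi : truth at the root n = [set: 'I_n] *)
Definition sem_conseq (n : nat) (Gamma : form -> Prop) (phi : form) : Prop :=
  forall V : nat -> {set 'I_n} -> Prop, valuation V ->
    (forall g, Gamma g -> forces V [set: 'I_n] g) -> forces V [set: 'I_n] phi.

(* Main.v *)
Require Import Defs.
From mathcomp Require Import boolp classical_sets.
From mathcomp Require Import all_boot.
Set Implicit Arguments. Unset Strict Implicit. Unset Printing Implicit Defensive.

(** If [alpha] is not derivable, rule Ed_n (after renaming variables to make room for
    fresh ones) gives a prime theory [Delta] omitting [alpha] and every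
    [Neg (lam ps p)], hence n distinct maximal extensions [e i] of [Delta]. By kp, for
    each prime theory [x] and each nonempty set S of indices with [x] contained in
    every [e i], i in S, the theory generated by [x] and the negations common to these
    [e i] is prime. By bd_n, no strict chain of prime theories has n + 1 members;
    comparing this with the chains obtained by removing indices one at a time shows
    that the prime theories above [Delta] are exactly those generated by [Delta] and the
    negations common to the [e i], i in S. Hence the part of the canonical model above
    [Delta] is a model on F_n. *)

Local Open Scope classical_set_scope.

(** * Derivability from a set of formulas *)

(** Formulas of [G] enter only modus ponens, while substitution and Ed stay inside [ML]; hence the
    deduction theorem [prv_imp] holds. *)
Inductive prv (n : nat) (G : set form) : form -> Prop :=
| prv_hyp a : G a -> prv n G a
| prv_ML a : ML n a -> prv n G a
| prv_mp a b : prv n G (Imp a b) -> prv n G a -> prv n G b.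

Definition extend (G : set form) (a : form) : set form := fun b => G b \/ b = a.

Lemma mem_In (T : eqType) (x : T) (s : seq T) : x \in s -> List.In x s.
Proof.
by elim: s => //= y s IHs; rewrite inE => /predU1P[->|/IHs]; [left|right].
Qed.

Lemma proper_of_neq (T : Type) (A B : set T) : A `<=` B -> A <> B -> A `<` B.
Proof. by move=> AB neq; split=> // BA; apply: neq; apply/seteqP. Qed.

Section Provability.
Variable n : nat.
Implicit Types (G H : set form) (a b c : form).

Lemma prv_sub G H a : (forall b, G b -> prv n H b) -> prv n G a -> prv n H a.
Proof.
move=> GH; elim=> {a} [a /GH //|a|a b _ IHab _ IHa]; first exact: prv_ML.
exact: prv_mp IHab IHa.
Qed.

Lemma prv_extend G a b : prv n G b -> prv n (extend G a) b.
Proof. by apply: prv_sub => c Gc; apply: prv_hyp; left. Qed.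

Lemma prv_last G a : prv n (extend G a) a.
Proof. by apply: prv_hyp; right. Qed.

Lemma prv_imp G a b : prv n (extend G a) b -> prv n G (Imp a b).
Proof.
elim=> {b} [b [Gb|->]|b Mb|b c _ IHbc _ IHb].
- exact: prv_mp (prv_ML _ (ax_K _ _ _)) (prv_hyp _ Gb).
- have S := ax_S n a (Imp a a) a.
  exact: prv_ML (r_MP (r_MP S (ax_K _ _ _)) (ax_K _ _ _)).
- exact: prv_mp (prv_ML _ (ax_K _ _ _)) (prv_ML _ Mb).
- exact: prv_mp (prv_mp (prv_ML _ (ax_S _ _ _ _)) IHbc) IHb.
Qed.

Lemma prv_and G a b : prv n G a -> prv n G b -> prv n G (And a b).
Proof. by move=> Ga; apply: prv_mp; apply: prv_mp Ga; exact/prv_ML/ax_A3. Qed.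

Lemma prv_and1 G a b : prv n G (And a b) -> prv n G a.
Proof. by apply: prv_mp; exact/prv_ML/ax_A1. Qed.

Lemma prv_and2 G a b : prv n G (And a b) -> prv n G b.
Proof. by apply: prv_mp; exact/prv_ML/ax_A2. Qed.

Lemma prv_or1 G a b : prv n G a -> prv n G (Or a b).
Proof. by apply: prv_mp; exact/prv_ML/ax_O1. Qed.

Lemma prv_or2 G a b : prv n G b -> prv n G (Or a b).
Proof. by apply: prv_mp; exact/prv_ML/ax_O2. Qed.

Lemma prv_or_elim G a b c :
  prv n G (Or a b) -> prv n G (Imp a c) -> prv n G (Imp b c) -> prv n G c.
Proof.
move=> Gab Gac Gbc; apply: prv_mp Gab.
by apply: prv_mp Gbc; apply: prv_mp Gac; exact/prv_ML/ax_O3.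
Qed.

Lemma prv_bot G a : prv n G Bot -> prv n G a.
Proof. by apply: prv_mp; exact/prv_ML/ax_E. Qed.

Lemma prv_bigAnd_in G l a : prv n G (bigAnd l) -> List.In a l -> prv n G a.
Proof.
elim: l => [|b [|c l] IHl] //= Gl; first by case=> [<-|[]].
case=> [<-|]; first exact: prv_and1 Gl.
exact: IHl (prv_and2 Gl).
Qed.

Lemma prv_bigAnd G l : (forall a, List.In a l -> prv n G a) -> prv n G (bigAnd l).
Proof.
elim: l => [|b [|c l] IHl] Gl; first exact/prv_ML/ax_E.
  by apply: Gl; left.
by apply: prv_and; [apply: Gl; left|apply: IHl => a al; apply: Gl; right].
Qed.

Lemma prv_bigOr_in G l a : List.In a l -> prv n G a -> prv n G (bigOr l).
Proof.
elim: l => [|b [|c l] IHl] //= al Ga; first by case: al => [->|[]].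
case: al => [->|al]; first exact: prv_or1.
exact/prv_or2/IHl.
Qed.

Lemma prv0_ML a : prv n (fun=> False) a -> ML n a.
Proof. by elim=> // b c _ Mbc _; exact: r_MP Mbc. Qed.

Lemma prv_derives G a : prv n G a -> derives n G a.
Proof.
move=> Ga.
suff [l lG la] : exists2 l, (forall g, List.In g l -> G g) &
    prv n (fun g => List.In g l) a.
  exists l; split=> //; apply: prv0_ML; apply: prv_imp.
  by apply: prv_sub la => g; apply: prv_bigAnd_in; exact: prv_last.
elim: Ga => {a} [a Ga|a Ma|a b _ [l lG la] _ [k kG kb]].
- by exists [:: a] => [g [<-|[]]//|]; apply: prv_hyp; left.
- by exists [::] => //; exact: prv_ML.
- exists (l ++ k) => [g /(List.in_app_or _ _ _)[/lG|/kG] //|].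
  by apply: (@prv_mp _ _ a); [move: la|move: kb];
    apply: prv_sub => g gl; apply/prv_hyp/List.in_or_app; [left|right].
Qed.

(** * Prime theories: existence and bounded depth *)

(** A derivation uses finitely many hypotheses, so by totality one member of [F] suffices; the left
    alternative covers an empty [F] in Zorn's lemma. *)
Lemma prv_bigcup (F : set (set form)) G a :
  total_on F classical_sets.subset -> prv n (G `|` \bigcup_(X in F) X) a ->
  prv n G a \/ exists2 X, F X & prv n (G `|` X) a.
Proof.
move=> totF; elim=> {a} [a [Ga|[X FX Xa]]|a Ma|a b _ IHab _ IHa].
- by left; exact: prv_hyp.
- by right; exists X => //; apply: prv_hyp; right.
- by left; exact: prv_ML.
have subU X c : prv n G c -> prv n (G `|` X) c.
  by apply: prv_sub => d Gd; apply: prv_hyp; left.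
have monU X Y c : X `<=` Y -> prv n (G `|` X) c -> prv n (G `|` Y) c.
  move=> XY; apply: prv_sub => d [Gd|/XY Yd]; apply: prv_hyp; [by left|by right].
case: IHab IHa => [Gab|[X FX Xab]] [Ga|[Y FY Ya]].
- by left; exact: prv_mp Gab Ga.
- by right; exists Y => //; exact: prv_mp (subU _ _ Gab) Ya.
- by right; exists X => //; exact: prv_mp Xab (subU _ _ Ga).
- have [XY|YX] := totF _ _ FX FY; right.
    by exists Y => //; exact: prv_mp (monU _ _ _ XY Xab) Ya.
  by exists X => //; exact: prv_mp Xab (monU _ _ _ YX Ya).
Qed.

Definition closed_theory (x : set form) : Prop := forall a, prv n x a -> x a.

Definition prime_theory (x : set form) : Prop :=
  [/\ closed_theory x, ~ x Bot & forall a b, x (Or a b) -> x a \/ x b].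

Lemma closed_theory_ML x a : closed_theory x -> ML n a -> x a.
Proof. by move=> xT Ma; apply: xT; exact: prv_ML. Qed.

Lemma closed_theory_mp x a b : closed_theory x -> x (Imp a b) -> x a -> x b.
Proof. by move=> xT xab xa; apply: xT; apply: prv_mp (prv_hyp _ xa); exact: prv_hyp. Qed.

(** Zorn's lemma gives a maximal set among those that do not prove [c] together with [G]; maximality
    yields the last clause, which for [c = Bot] makes [x] a maximal consistent theory. *)
Lemma Lindenbaum G c : ~ prv n G c -> exists2 x, prime_theory x &
  [/\ G `<=` x, ~ x c & forall a, ~ x a -> x (Imp a c)].
Proof.
move=> Gc.
have [F FP totF|X [PX maxX]] := @Zorn_bigcup form (fun X => ~ prv n (G `|` X) c).
  by case/(prv_bigcup totF) => [//|[X /FP]].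
pose x := [set a | prv n (G `|` X) a].
have xT : closed_theory x by move=> a; apply: prv_sub.
have xmax a : ~ x a -> x (Imp a c).
  move=> xa; apply: contrapT => xac; apply: (maxX (extend X a)).
    split=> [b Xb|sub]; first by left.
    by apply: xa; apply: prv_hyp; right; apply: sub; right.
  move=> Gac; apply: xac; apply: prv_imp; apply: prv_sub Gac => b.
  by case=> [Gb|[Xb|->]]; apply: prv_hyp; [left; left|left; right|right].
exists x; last by split=> // a Ga; apply: prv_hyp; left.
split=> // [xB|a b xab]; first by apply: PX; exact: prv_bot.
apply: contrapT => /not_orP[/xmax xa /xmax xb]; apply: PX.
exact: prv_or_elim xab xa xb.
Qed.

(* [k] counts the strict inclusions, so the chain has [k.+1] members. *)
Fixpoint has_chain (k : nat) (x : set form) : Prop :=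
  if k is k'.+1 then exists y, [/\ prime_theory y, x `<` y & has_chain k' y] else True.

Lemma subst_bd k (s t : nat -> form) :
  (forall p, p <= k -> s p = t p) -> subst s (bd k) = subst t (bd k).
Proof.
elim: k => //= k IHk st; rewrite IHk ?st // => p pk.
by apply: st; exact: leq_trans pk _.
Qed.

(** Sending variable [k.+1] to a formula of [y] outside [x] excludes the first disjunct, so [y]
    contains the matching instance of [bd k]. The substitution is arbitrary on the other variables,
    so the induction goes on. *)
Lemma bd_no_chain k x : prime_theory x ->
  (forall s, x (subst s (bd k))) -> ~ has_chain k x.
Proof.
elim: k x => [|k IHk] x xP xbd; first by case: xP => _ /(_ (xbd Var)).
move=> [y [yP xy ych]]; apply: IHk ych => // s.
case: xy => xy /existsNP[a /not_implyP[ya xa]].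
have [xT _ xprime] := xP; have [yT _ _] := yP.
have /xprime[|] := xbd (fun p => if p == k.+1 then a else s p); rewrite /= eqxx //.
move=> /xy xak; rewrite (subst_bd (t := fun p => if p == k.+1 then a else s p)).
  exact: closed_theory_mp yT xak ya.
by move=> p; case: eqP => // ->; rewrite ltnn.
Qed.

Lemma no_chain x : prime_theory x -> ~ has_chain n x.
Proof.
move=> xP; apply: bd_no_chain => // s; have [xT _ _] := xP.
by apply: closed_theory_ML => //; apply: r_US; exact: ax_bd.
Qed.

End Provability.

(** * Adjoining the negations common to some maximal theories *)

Section CanonicalModel.
Variables (n : nat) (e : 'I_n -> set form) (l : 'I_n -> form) (Delta : set form).
Hypothesis eP : forall i, prime_theory n (e i).
Hypothesis emax : forall i a, ~ e i a -> e i (Neg a).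
Hypothesis el : forall i, e i (l i).
Hypothesis el' : forall i j, i != j -> e i (Neg (l j)).
Hypothesis Delta_e : forall i, Delta `<=` e i.
Hypothesis DeltaP : prime_theory n Delta.
Hypothesis n_gt0 : 0 < n.

Implicit Types (x y : set form) (S : {set 'I_n}).

(* One [b] suffices, since a conjunction of negations is the negation of a disjunction. *)
Definition adjoin x S : set form :=
  [set a | exists2 b, (forall i, i \in S -> e i (Neg b)) & x (Imp (Neg b) a)].

Lemma e_closed i : closed_theory n (e i).
Proof. by case: (eP i). Qed.

Lemma e_consistent i a : e i a -> ~ e i (Neg a).
Proof.
move=> ea eNa; case: (eP i) => eT eB _; apply: eB.
exact: closed_theory_mp eT eNa ea.
Qed.

Lemma sub_adjoin x S : closed_theory n x -> x `<=` adjoin x S.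
Proof.
move=> xT a xa; exists Bot => [i _|]; first by apply: emax; case: (eP i).
by apply: xT; apply: prv_imp; apply: prv_extend; exact: prv_hyp.
Qed.

Lemma adjoin_neg x S a : closed_theory n x ->
  (forall i, i \in S -> e i (Neg a)) -> adjoin x S (Neg a).
Proof.
by move=> xT ea; exists a => //; apply: xT; apply: prv_imp; exact: prv_last.
Qed.

Lemma adjoinS x S S' : S \subset S' -> adjoin x S' `<=` adjoin x S.
Proof. by move=> /subsetP sub a [b eb xba]; exists b => // i /sub; exact: eb. Qed.

Lemma adjoin_sub_e x S i : i \in S -> x `<=` e i -> adjoin x S `<=` e i.
Proof.
move=> iS xe a [b /(_ i iS) eb /xe xa]; exact: closed_theory_mp (@e_closed i) xa eb.
Qed.

Lemma adjoin_closed x S : closed_theory n x -> closed_theory n (adjoin x S).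
Proof.
move=> xT a; elim=> {a} [//|a Ma|a b _ [c ec xc] _ [d ed xd]].
  by apply: (sub_adjoin S xT); exact: closed_theory_ML xT Ma.
exists (Or c d) => [i iS|].
  apply: e_closed; apply: prv_imp; apply: prv_or_elim (prv_last _ _ _) _ _.
    by apply: prv_extend; apply: prv_hyp; exact: ec.
  by apply: prv_extend; apply: prv_hyp; exact: ed.
apply: xT; apply: prv_imp; have N := prv_last n x (Neg (Or c d)).
apply: (@prv_mp _ _ a).
  apply: prv_mp (prv_extend _ (prv_hyp _ xc)) _.
  by apply: prv_imp; apply: prv_mp (prv_extend _ N) _; exact/prv_or1/prv_last.
apply: prv_mp (prv_extend _ (prv_hyp _ xd)) _.
by apply: prv_imp; apply: prv_mp (prv_extend _ N) _; exact/prv_or2/prv_last.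
Qed.

Lemma adjoin_prime x S : prime_theory n x -> S != set0 ->
  (forall i, i \in S -> x `<=` e i) -> prime_theory n (adjoin x S).
Proof.
move=> xP /set0Pn[i iS] xe; have [xT _ _] := xP; split; first exact: adjoin_closed.
  by move=> /(adjoin_sub_e iS (xe i iS)); case: (eP i).
move=> a b [c ec xc].
(* With variables 0, 1, 2 read as [c], [a], [b], kp splits [Imp (Neg c) (Or a b)] into a
   disjunction, to which the primeness of [x] applies. *)
have kpI := r_US (fun p => if p is p'.+1 then if p' is 0 then a else b else c) (ax_kp n).
have [c_a|c_b] : x (Imp (Neg c) a) \/ x (Imp (Neg c) b).
  case: xP => _ _; apply.
  exact: closed_theory_mp xT (closed_theory_ML xT kpI) xc.
by left; exists c.
by right; exists c.
Qed.

(** [Neg (l i)] separates the two: it lies in every [e j] with [j] in [S], but not in [e i], hence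
    not in [x]. *)
Lemma adjoin_proper x S i : closed_theory n x -> i \notin S -> x `<=` e i ->
  x `<` adjoin x S.
Proof.
move=> xT iS xe; split; first exact: sub_adjoin.
move=> /(_ (Neg (l i)))/= sub; apply: (e_consistent (el i)); apply/xe/sub.
apply: adjoin_neg => // j jS; apply: el'.
by apply: contraNneq iS => <-.
Qed.

(** Each index dropped from [S] gives a strictly larger prime theory; after [k] removals one index
    is left. *)
Lemma has_chain_up k x S : #|S| = k.+1 -> prime_theory n x ->
  (forall i, i \in S -> x `<=` e i) -> has_chain n k x.
Proof.
elim: k x S => [//|k IHk] x S cS xP xe.
have [i iS] : exists i, i \in S by apply/set0Pn; rewrite -card_gt0 cS.
have [xT _ _] := xP.
have cSi : #|S :\ i| = k.+1 by move: cS; rewrite (cardsD1 i) iS => -[].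
have xe' j : j \in S :\ i -> x `<=` e j by rewrite !inE => /andP[_]; exact: xe.
have yP : prime_theory n (adjoin x (S :\ i)).
  by apply: adjoin_prime => //; rewrite -card_gt0 cSi.
exists (adjoin x (S :\ i)); split=> //.
  by apply: (@adjoin_proper _ _ i) => //; [rewrite !inE eqxx|exact: xe].
by apply: (IHk _ (S :\ i)) => // j jS; apply: adjoin_sub_e => //; exact: xe'.
Qed.

(** * The prime theories above [Delta] *)

Let T := adjoin Delta.

Lemma Delta_closed : closed_theory n Delta.
Proof. by case: DeltaP. Qed.

Lemma T_prime S : S != set0 -> prime_theory n (T S).
Proof. by move=> S0; apply: adjoin_prime => //; exact: Delta_closed. Qed.

Lemma T_proper S i : i \notin S -> T (i |: S) `<` T S.
Proof.
move=> iS; split; first by apply: adjoinS; exact: subsetUr.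
move=> /(_ (Neg (l i))) sub.
apply: (e_consistent (el i)); apply: (@adjoin_sub_e Delta (i |: S)) => //.
  exact: setU11.
apply: sub; apply: adjoin_neg; first exact: Delta_closed.
by move=> j jS; apply: el'; apply: contraNneq iS => <-.
Qed.

(** Restoring the missing indices one by one prolongs a chain downwards from [T S]; at the full
    index set it would have [n] strict inclusions, against [no_chain]. *)
Lemma T_no_chain S : S != set0 -> ~ has_chain n #|S| (T S).
Proof.
elim/(@ltn_ind) : {S}(n - #|S|)%N {-2}S (erefl (n - #|S|)%N) => k IHk S kE S0.
have [ST|] := eqVneq S [set: 'I_n]%SET.
  by rewrite ST cardsT card_ord; apply: no_chain; apply: T_prime; rewrite -ST.
rewrite -finset.subTset => /subsetPn[i _ iS] ch.
have iS0 : i |: S != set0 by apply/set0Pn; exists i; exact: setU11.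
apply: (IHk (n - #|i |: S|)%N _ (i |: S) erefl iS0).
  rewrite -kE cardsU1 iS; apply: ltn_sub2l => //.
  by rewrite -[n in (_ < n)%N]card_ord (leq_trans _ (max_card (mem (i |: S)))) // cardsU1 iS.
rewrite cardsU1 iS; exists (T S); split=> //; [exact: T_prime|exact: T_proper].
Qed.

(** Were [Delta] strictly below [T] of the full set, it would prolong the [n.-1] strict inclusions
    obtained there by dropping indices to [n] of them. *)
Lemma DeltaE : Delta = T [set: 'I_n]%SET.
Proof.
apply: contrapT => neq; apply: (@no_chain n Delta) => //.
have T0 : [set: 'I_n]%SET != set0 by rewrite -card_gt0 cardsT card_ord.
have ch : has_chain n n.-1 (T [set: 'I_n]%SET).
  apply: (@has_chain_up _ _ [set: 'I_n]%SET).
  - by rewrite cardsT card_ord prednK.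
  - exact: T_prime.
  - by move=> i iT; apply: adjoin_sub_e.
suff : has_chain n n.-1.+1 Delta by rewrite prednK.
exists (T [set: 'I_n]%SET); split=> //; first exact: T_prime.
apply: proper_of_neq => //; apply: sub_adjoin; exact: Delta_closed.
Qed.

Lemma below_max x a : closed_theory n x -> Delta `<=` x -> ~ x (Neg a) ->
  exists i, x `<=` e i /\ e i a.
Proof.
move=> xT Dx xNa.
have [|m mP [xm mB mmax]] := @Lindenbaum n (extend x a) Bot.
  by move=> xaB; apply: xNa; apply: xT; exact: prv_imp.
have {}mmax b : ~ m b -> m (Neg b) by exact: mmax.
have [mT _ _] := mP.
suff [i mi] : exists i, m `<=` e i.
  by exists i; split=> [b xb|]; apply/mi/xm; [left|right].
(* Otherwise pick for each [i] a formula of [m] outside [e i]. The negation of their conjunction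
   lies in all [e i], so in [T] of the full set, which is [Delta], and so in [m]. *)
apply: contrapT => /forallNP nm.
have /choice[f mf] i : exists b, m b /\ ~ e i b.
  by have /existsNP[b /not_implyP] := nm i; exists b.
pose c := bigAnd [seq f i | i <- enum 'I_n].
have fc G i : prv n G c -> prv n G (f i).
  move/prv_bigAnd_in; apply; apply: List.in_map.
  by apply: mem_In; rewrite mem_enum.
have mc : m c.
  apply: mT; apply: prv_bigAnd => b.
  by move=> /(List.in_map_iff _ _ _)[i [<- _]]; apply: prv_hyp; case: (mf i).
suff /xm mNc : extend x a (Neg c) by apply: mB; exact: closed_theory_mp mT mNc mc.
left; apply: Dx; rewrite DeltaE; apply: adjoin_neg; first exact: Delta_closed.
move=> i _; apply: e_closed; apply: prv_imp.
apply: prv_mp (fc _ i (prv_last _ _ _)); apply: prv_extend; apply: prv_hyp.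
by apply: emax; case: (mf i).
Qed.

Lemma TE x : prime_theory n x -> Delta `<=` x ->
  exists2 S, S != set0 & x = T S.
Proof.
move=> xP Dx; have [xT xB _] := xP.
pose S := [set i | `[< x `<=` e i >]]%SET.
have SP i : reflect (x `<=` e i) (i \in S) by rewrite inE; exact: asboolP.
have S0 : S != set0.
  have [|i [xi _]] := @below_max x Top xT Dx.
    move=> xN; apply: xB; apply: xT; apply: prv_mp (prv_hyp _ xN) _.
    exact/prv_ML/ax_E.
  by apply/set0Pn; exists i; apply/SP.
exists S => //.
(* Were [Neg b] not in [x], some [e i] above [x] would contain [b], against the choice of [b]. *)
have Tx : T S `<=` x.
  move=> a [b eb Dba]; apply: (closed_theory_mp xT (Dx _ Dba)).
  apply: contrapT => /(below_max xT Dx)[i [/SP iS eib]].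
  exact: e_consistent eib (eb i iS).
(* A strict inclusion of [T S] in [x], followed by the [#|S|.-1] strict inclusions above [x], is too
   long a chain above [T S]. *)
apply: contrapT => neq; apply: (T_no_chain S0).
have cS : #|S| = #|S|.-1.+1 by rewrite prednK // card_gt0.
rewrite cS; exists x; split=> //.
  by apply: proper_of_neq => // /esym.
by apply: (has_chain_up cS) => // i /SP.
Qed.

(** * The truth lemma *)

(** Reading variable [p] as [s p] evaluates an original formula through its renamed copy. *)
Definition canonical (s : nat -> form) (p : nat) (S : {set 'I_n}) : Prop := T S (s p).

Lemma canonical_valuation s : valuation (canonical s).
Proof. by move=> p S S' _ _ S'S; exact: adjoinS. Qed.

Lemma truth s S a : S != set0 -> forces (canonical s) S a <-> T S (subst s a).
Proof.
elim: a S => [p|//|a IHa b IHb|a IHa b IHb|a IHa b IHb] S S0 /=.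
- by [].
- by split=> //; case: (T_prime S0).
- have [TT _ _] := T_prime S0; rewrite (IHa S) // (IHb S) //; split.
    by move=> [Ta Tb]; apply/TT/prv_and; exact: prv_hyp.
  by move=> /(prv_hyp n) Tab; split; apply: TT;
    [exact: prv_and1 Tab|exact: prv_and2 Tab].
- have [TT _ Tor] := T_prime S0; rewrite (IHa S) // (IHb S) //; split.
    by move=> [Ta|Tb]; apply: TT; [apply: prv_or1|apply: prv_or2]; exact: prv_hyp.
  exact: Tor.
- have [TT _ _] := T_prime S0; split=> [fab|Tab S' S'0 S'S]; last first.
    rewrite (IHa S') // (IHb S') //; have [T'T _ _] := T_prime S'0.
    exact: closed_theory_mp T'T (adjoinS S'S Tab).
  apply: contrapT => nTab.
  (* By [TE], a prime theory refuting the implication is [T S'] for a world [S']. *)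
  have [|y yP [Ty yb _]] := @Lindenbaum n (extend (T S) (subst s a)) (subst s b).
    by move=> Tb; apply/nTab/TT/prv_imp.
  have [c Dc|S' S'0 yE] := TE yP.
    by apply: Ty; left; apply: sub_adjoin => //; exact: Delta_closed.
  apply: yb; rewrite yE; apply/IHb => //; apply: fab => //; last first.
    by apply/IHa => //; rewrite -yE; apply: Ty; right.
  (* For an index [i] of [S'] outside [S], [Neg (l i)] would lie in [T S], hence in [e i]. *)
  apply/subsetP => i iS'; apply: contrapT => /negP iS.
  apply: (e_consistent (el i)).
  have : y `<=` e i by rewrite yE; apply: adjoin_sub_e.
  apply; apply: Ty; left; apply: adjoin_neg; first exact: Delta_closed.
  by move=> j jS; apply: el'; apply: contraNneq iS => <-.
Qed.

End CanonicalModel.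

(** * Renaming of variables and the rule Ed *)

Lemma vars_bigAnd (P : nat -> Prop) l :
  (forall a p, List.In a l -> p \in vars a -> P p) ->
  forall p, p \in vars (bigAnd l) -> P p.
Proof.
elim: l => [|a [|b l] IHl] //= lP p; first by apply: lP; left.
rewrite mem_cat => /orP[|pl]; first by apply: lP; left.
by apply: IHl pl => c q cl; apply: lP; right.
Qed.

(** [Gamma] may mention every variable, so all are moved up by [n], which leaves the first [n] free
    for Ed. *)
Definition shift (n p : nat) : form := Var (p + n).
Definition unshift (n p : nat) : form := Var (p - n).

Lemma shiftK n a : subst (unshift n) (subst (shift n) a) = a.
Proof. by elim: a => //= [p|a -> b ->|a -> b ->|a -> b ->] //; rewrite /unshift addnK. Qed.

Lemma vars_shift n a p : p \in vars (subst (shift n) a) -> n <= p.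
Proof.
elim: a => [q||a IHa b IHb|a IHa b IHb|a IHa b IHb] //=;
  try by rewrite mem_cat => /orP[/IHa|/IHb].
by rewrite inE => /eqP->; exact: leq_addl.
Qed.

Lemma subst_bigAnd s l : subst s (bigAnd l) = bigAnd [seq subst s a | a <- l].
Proof. by elim: l => [|a [|b l] IHl] //=; congr And; exact: IHl. Qed.

Definition lambda n (i : 'I_n) : form := lam (iota 0 n) i.

(** The renamed premises and conclusion avoid the variables below [n], so Ed drops the disjunction
    of negations; substituting [unshift] then restores the original formulas. *)
Lemma shift_Ed n (Gamma : form -> Prop) alpha :
  prv n (fun g => exists2 g0, Gamma g0 & g = subst (shift n) g0)
    (Or (subst (shift n) alpha) (bigOr [seq Neg (lam (iota 0 n) p) | p <- iota 0 n])) ->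
  derives n Gamma alpha.
Proof.
move=> /prv_derives[k [kG]] Mk; exists [seq subst (unshift n) g | g <- k]; split.
  by move=> g /(List.in_map_iff _ _ _)[h [<- /kG[g0 Gg0 ->]]]; rewrite shiftK.
rewrite -subst_bigAnd -[alpha](shiftK n).
apply: (r_US (unshift n) (a := Imp (bigAnd k) (subst (shift n) alpha))).
apply: r_Ed Mk; [exact: size_iota|exact: iota_uniq|].
move=> p; rewrite mem_iota /= add0n => pn; split; apply: contraTN pn; rewrite -leqNgt.
  by apply: (vars_bigAnd (P := fun p => n <= p)) => a q /kG[g0 _ ->]; exact: vars_shift.
exact: vars_shift.
Qed.

(** * The maximal theories [e i] and completeness *)

Lemma lambda_var n x (i : 'I_n) : closed_theory n x -> x (lambda i) -> x (Var i).
Proof. by move=> xT xl; apply: xT; exact: prv_and1 (prv_hyp _ xl). Qed.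

Lemma lambda_neg_var n x (i j : 'I_n) :
  closed_theory n x -> x (lambda i) -> i != j -> x (Neg (Var j)).
Proof.
move=> xT xl ij; apply: xT; apply: prv_bigAnd_in (prv_and2 (prv_hyp _ xl)) _.
apply: (List.in_map (fun p => Neg (Var p))); apply: mem_In.
by rewrite mem_filter mem_iota /= ltn_ord eq_sym ij.
Qed.

Theorem mainTheorem8 (n : nat) (Gamma : form -> Prop) (alpha : form) :
  1 <= n -> sem_conseq n Gamma alpha -> derives n Gamma alpha.
Proof.
move=> n_gt0 Gamma_alpha; apply: contrapT => nder.
have /Lindenbaum[Delta DeltaP [GD Dalpha _]] := contra_not (@shift_Ed n Gamma alpha) nder.
have [DT _ _] := DeltaP.
have /choice[e eP] (i : 'I_n) : exists m, [/\ prime_theory n m, Delta `<=` m,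
    m (lambda i) & forall a, ~ m a -> m (Neg a)].
  (* [Delta] omits [Neg (lambda i)], so it is consistent with [lambda i]; omitting [Bot] makes [m]
     maximal. *)
  have [|m mP [Dm _ mmax]] := @Lindenbaum n (extend Delta (lambda i)) Bot.
    move=> /prv_imp Dl; apply: Dalpha; apply: DT; apply: prv_or2.
    apply: prv_bigOr_in Dl; apply: (List.in_map (fun p => Neg (lam (iota 0 n) p))).
    by apply: mem_In; rewrite mem_iota ltn_ord.
  by exists m; split=> // [a Da|]; apply: Dm; [left|right].
have e1 i : prime_theory n (e i) by case: (eP i).
have e2 i a : ~ e i a -> e i (Neg a) by case: (eP i) => _ _ _; exact.
have e3 i : e i (lambda i) by case: (eP i).
have e4 i : Delta `<=` e i by case: (eP i).
have e5 i j : i != j -> e i (Neg (lambda j)).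
  (* [lambda i] yields [Neg (Var j)], whereas [lambda j] yields [Var j]. *)
  move=> ij; have [eT eB _] := e1 i; apply: e2 => elj; apply: eB.
  apply: (closed_theory_mp eT (lambda_neg_var eT (e3 i) ij)).
  exact: lambda_var elj.
have root : [set: 'I_n]%SET != set0 by rewrite -card_gt0 cardsT card_ord.
have DE := DeltaE e1 e2 e3 e5 e4 DeltaP n_gt0.
have tr a := truth e1 e2 e3 e5 e4 DeltaP n_gt0 (shift n) a root.
(* The root corresponds to [Delta], which contains the renamed [Gamma]; it would thus contain the
   renamed [alpha], a disjunct of the omitted formula. *)
apply: Dalpha; apply: DT; apply: prv_or1; apply: prv_hyp.
rewrite DE; apply/tr; apply: Gamma_alpha; first exact: canonical_valuation.
by move=> g Gg; apply/tr; rewrite -DE; apply: GD; exists g.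
Qed.
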